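(* Let $\Lambda\colon\mathbb{R}\to[0,1]$ be in standard representation, satisfy the attainment condition (equivalently, be right lower semicontinuous), and be such that $Q_\Lambda^-(F)\in\mathbb{R}$ for all $F\in\mathcal M$. Let $\rho\colon\mathcal L^0\to\mathbb{R}$, $\rho(X):=Q_\Lambda^-(F_X)$, where $F_X=\mathbb{P}(X\le\cdot)$. Then $$\mathcal G(\rho)=\mathcal G(\Lambda).$$
   Context: $\mathcal M$ is the set of cumulative distribution functions on $\mathbb{R}$, and $\mathcal L^0$ is the space of all real-valued random variables on an atomless probability space $(\Omega,\mathcal F,\mathbb{P})$ (so every $F\in\mathcal M$ is the CDF of some $X\in\mathcal L^0$). For $F\in\mathcal M$, $Q_\Lambda^-(F):=\inf\{x\in\mathbb{R}\mid F(x)\ge\Lambda(x)\}$, with $\inf\varnothing=\infty$. Let $N_0:=\inf\{x\in\mathbb{R}\mid\Lambda(x)=0\}$; $\Lambda$ is in standard representation if $\Lambda(x)=0$ for all real $x>N_0$. The attainment condition: $F(Q_\Lambda^-(F))\ge\Lambda(Q_\Lambda^-(F))$ for all $F\in\mathcal M$ with $Q_\Lambda^-(F)\in\mathbb{R}$; for $\Lambda$ in standard representation this is equivalent to right lower semicontinuity, $\liminf_{y\downarrow x}\Lambda(y)\ge\Lambda(x)$ for all $x\in\mathbb{R}$. $\mathcal S$ is the group (under composition) of all strictly increasing, continuous, surjective $g\colon\mathbb{R}\to\mathbb{R}$. The ordinal covariance group of $\rho$ is $\mathcal G(\rho):=\{g\in\mathcal S\mid\rho(g(X))=g(\rho(X))\text{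 for all }X\in\mathcal L^0\}$, and the invariance group of $\Lambda$ is $\mathcal G(\Lambda):=\{g\in\mathcal S\mid\Lambda\circ g=\Lambda\}$. *)

(* Defs.v *)
From HB Require Import structures.
From mathcomp Require Import all_boot all_order all_algebra.
From mathcomp Require Import all_classical all_reals all_analysis.
From mathcomp Require Import measurable_realfun.
Set Implicit Arguments.
Unset Strict Implicit.
Unset Printing Implicit Defensive.
Import Order.TTheory GRing.Theory Num.Theory.
Import numFieldNormedType.Exports.
Local Open Scope classical_set_scope.
Local Open Scope ring_scope.

Definition atomless d (T : measurableType d) (R : realType)
    (P : probability T R) : Prop :=
  forall A : set T, measurable A -> (0 < P A)%E ->
    exists B : set T, [/\ measurable B, B `<=` A, (0 < P B)%E & (P B < P A)%E].

(* The set of cumulative distribution functions on R: nondecreasing,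
   right-continuous, with limit 0 at -oo and 1 at +oo. *)
Notation CDF R := (cumulativeBounded (0 : R) (1 : R)).

(* F_X as a real-valued function; the library's [cdf] is \bar R-valued. *)
Definition cdfR d (T : measurableType d) (R : realType) (P : probability T R)
  (X : {RV P >-> R}) (x : R) : R := fine (cdf X x).

Section cdfR_is_CDF.
Context d (T : measurableType d) (R : realType) (P : probability T R).
Variable X : {RV P >-> R}.

Lemma cdfR_nondecreasing : nondecreasing (cdfR X).
Proof. by move=> *; rewrite fine_le ?fin_num_measure// cdf_nondecreasing. Qed.

Lemma cdfR_right_continuous : right_continuous (cdfR X).
Proof.
move=> a; apply: fine_cvg.
by rewrite fineK ?fin_num_measure//; exact: cdf_right_continuous.
Qed.

Lemma cdfR_cvgNy : cdfR X @ -oo --> (0 : R).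
Proof. exact/fine_cvg/cvg_cdfNy0. Qed.

Lemma cdfR_cvgy : cdfR X @ +oo --> (1 : R).
Proof. exact/fine_cvg/cvg_cdfy1. Qed.

HB.instance Definition _ := isCumulative.Build R _ R (cdfR X)
  cdfR_nondecreasing cdfR_right_continuous.
HB.instance Definition _ := isCumulativeBounded.Build R 0 1 (cdfR X)
  cdfR_cvgNy cdfR_cvgy.

End cdfR_is_CDF.

Section lambda_quantiles.
Context (R : realType).
Implicit Types (Lambda : R -> R).

(* Infima are taken in \bar R, so that inf set0 = +oo. *)
Definition lambda_quantile Lambda (F : CDF R) : \bar R :=
  ereal_inf (EFin @` [set x : R | Lambda x <= F x]).

Definition lambda_N0 Lambda : \bar R :=
  ereal_inf (EFin @` [set x : R | Lambda x = 0]).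

Definition standard_representation Lambda : Prop :=
  forall x : R, (lambda_N0 Lambda < x%:E)%E -> Lambda x = 0.

Definition attainment Lambda : Prop :=
  forall (F : CDF R) (q : R), lambda_quantile Lambda F = q%:E ->
    Lambda q <= F q.

End lambda_quantiles.

(* The carrier of the group of strictly increasing, continuous, surjective
   functions R -> R. *)
Record ordinal_transf (R : realType) := OrdinalTransf {
  ordinal_transf_fun :> R -> R ;
  ordinal_transf_incr : forall x y : R, x < y ->
    ordinal_transf_fun x < ordinal_transf_fun y ;
  ordinal_transf_cont : continuous ordinal_transf_fun ;
  ordinal_transf_surj : forall y : R, exists x : R, ordinal_transf_fun x = y }.

Lemma ordinal_transf_measurable (R : realType) (g : ordinal_transf R) :
  measurable_fun [set: R] g.
Proof. exact: (continuous_measurable_fun (@ordinal_transf_cont R g)). Qed.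

(* Makes [g \o X] a random variable for every [g : ordinal_transf R]. *)
HB.instance Definition _ (R : realType) (g : ordinal_transf R) :=
  isMeasurableFun.Build _ _ R R (ordinal_transf_fun g)
    (ordinal_transf_measurable g).

Definition covariance_group d (T : measurableType d) (R : realType)
    (P : probability T R) (rho : {RV P >-> R} -> R) : set (ordinal_transf R) :=
  [set g : ordinal_transf R | forall X : {RV P >-> R}, rho (g \o X : {RV P >-> R}) = g (rho X)].

Definition invariance_group (R : realType) (Lambda : R -> R) :
    set (ordinal_transf R) :=
  [set g : ordinal_transf R | Lambda \o g = Lambda].

(* Main.v *)
(* For q := rho X, the attainment condition makes q the least x with
   Lambda x <= F_X x, and F_(g X) (g x) = F_X x, so rho (g X) = g (rho X) says
   that Lambda and Lambda o g have the same minimizer for every F_X.  If X = x + 1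
   a.s., this shows, with the standard representation, that Lambda and Lambda o g
   have the same zeros.  If Lambda x > 0, then Lambda > 0 on ]-oo, x[, so the
   F that vanishes there and equals p at x, with p = Lambda x or
   p = Lambda (g x), has quantile x for one, hence both; this gives both inequalities
   between Lambda x and Lambda (g x).  Such an F is the law of a two-valued X,
   because an atomless space has events of every probability. *)
Require Import Defs.
From HB Require Import structures.
From mathcomp Require Import all_boot all_order all_algebra.
From mathcomp Require Import all_classical all_reals all_analysis.
From mathcomp Require Import measurable_realfun lra.
Import Order.TTheory GRing.Theory Num.Theory.
Import numFieldNormedType.Exports.
Set Implicit Arguments.
Unset Strict Implicit.
Unset Printing Implicit Defensive.
Local Open Scope classical_set_scope.
Local Open Scope ring_scope.

Lemma probability_setD (d : measure_display) (T : measurableType d)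
    (R : realType) (P : probability T R) (A B : set T) :
  measurable A -> measurable B -> B `<=` A ->
  fine (P (A `\` B)) = fine (P A) - fine (P B).
Proof.
move=> mA mB BA; rewrite measureD//; last first.
  by rewrite ltey_eq fin_num_measure.
by rewrite (setIidr BA) fineB// fin_num_measure.
Qed.

Lemma fine_probability_gt0 (d : measure_display) (T : measurableType d)
    (R : realType) (P : probability T R) (A : set T) :
  measurable A -> (0 < fine (P A)) = (0 < P A)%E.
Proof. by move=> mA; rewrite -lte_fin fineK// fin_num_measure. Qed.

Lemma fine_probability_le1 (d : measure_display) (T : measurableType d)
    (R : realType) (P : probability T R) (A : set T) :
  measurable A -> fine (P A) <= 1.
Proof.
by move=> mA; rewrite -lee_fin fineK ?fin_num_measure// probability_le1.
Qed.

(** Atomlessness splits [A] into two pieces of positive probability, and one of them carries at most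
    half of that of [A]. *)
Lemma atomless_half (d : measure_display) (T : measurableType d)
    (R : realType) (P : probability T R) (A : set T) :
  atomless P -> measurable A -> 0 < fine (P A) ->
  exists B, [/\ measurable B, B `<=` A, 0 < fine (P B) &
    fine (P B) * 2 <= fine (P A)].
Proof.
move=> Pat mA; rewrite fine_probability_gt0// => A0.
have [B [mB BA]] := Pat _ mA A0.
rewrite -fine_probability_gt0// => B0 BltA.
have {}BltA : fine (P B) < fine (P A).
  by rewrite -lte_fin !fineK ?fin_num_measure.
have [le|lt] := leP (fine (P B) * 2) (fine (P A)); first by exists B.
have mAB : measurable (A `\` B) by exact: measurableD.
by exists (A `\` B); rewrite probability_setD//; split=> //; lra.
Qed.

Lemma atomless_small (d : measure_display) (T : measurableType d)
    (R : realType) (P : probability T R) (A : set T) (e : R) :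
  atomless P -> measurable A -> 0 < fine (P A) -> 0 < e ->
  exists B, [/\ measurable B, B `<=` A, 0 < fine (P B) & fine (P B) < e].
Proof.
move=> Pat mA A0 e0.
(* After [n] halvings the probability is at most [1 / 2 ^ n], which is below [e] because
   [e^-1 < n + 1 <= 2 ^ n]. *)
pose n := Num.truncn e^-1.
suff [B [mB BA B0 Bn]] : exists B, [/\ measurable B, B `<=` A,
    0 < fine (P B) & fine (P B) * 2 ^+ n <= 1].
  exists B; split=> //; have e2 : 1 < e * 2 ^+ n.
    rewrite mulrC -ltr_pdivrMr// div1r (lt_le_trans (truncnS_gt _))//.
    by rewrite -natrX ler_nat ltn_expl.
  by rewrite -(@ltr_pM2r _ (2 ^+ n)) ?exprn_gt0// (le_lt_trans Bn).
elim: n => [|n [B [mB BA B0 Bn]]].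
  by exists A; rewrite expr0 mulr1; split=> //; exact: fine_probability_le1.
have [C [mC CB C0 Cn]] := atomless_half Pat mB B0.
exists C; split=> //; first exact: subset_trans BA.
by rewrite exprS mulrA (le_trans _ Bn)// ler_wpM2r// exprn_ge0.
Qed.

Lemma exists_maximal_probability (d : measure_display) (T : measurableType d)
    (R : realType) (P : probability T R) (p : R) : 0 <= p ->
  exists A, [/\ measurable A, fine (P A) <= p &
    forall B, measurable B -> A `<=` B -> fine (P B) <= p ->
      fine (P B) <= fine (P A)].
Proof.
move=> p0; pose adm A := measurable A /\ fine (P A) <= p.
(* [A'] halves the gap between [P A] and the supremum over admissible supersets
   of [A]; the union of the iterates of [A |-> A'] is therefore maximal. *)
have step A : exists A', adm A -> [/\ adm A', A `<=` A' &
    forall B, adm B -> A `<=` B ->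
      fine (P A) + fine (P B) <= fine (P A') * 2].
  (* A non-admissible [A] gets a dummy value, so that [choice] yields a total [f]. *)
  have [admA|nadmA] := pselect (adm A); last by exists A.
  pose E := [set fine (P B) | B in [set B | adm B /\ A `<=` B]].
  have EA : E (fine (P A)) by exists A => //; split.
  have Eub : has_ubound E by exists p => _ [B [[_ ?] _] <-].
  have := ub_le_sup Eub EA; rewrite le_eqVlt => /predU1P[EAsup|ltsup].
    exists A => _; split=> // B admB AB.
    have : fine (P B) <= sup E by apply: ub_le_sup => //; exists B.
    lra.
  have e0 : 0 < (sup E - fine (P A)) / 2 by lra.
  have [_ [A' [admA' AA'] <-] ltA'] :=
    sup_adherent e0 (conj (ex_intro _ _ EA) Eub).
  exists A' => _; split=> // B admB AB.
  have : fine (P B) <= sup E by apply: ub_le_sup => //; exists B.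
  lra.
have [f fP] := choice step.
pose F n := iter n f set0.
have F0 : adm (F 0%N) by split=> //=; rewrite measure0.
have admF n : adm (F n) by elim: n => // n /fP[].
have mF n : measurable (F n) by case: (admF n).
have mUF : measurable (\bigcup_n F n) by exact: bigcup_measurable.
have ndF : {homo F : n m / (n <= m)%N >-> (n <= m)%O}.
  by apply/nondecreasing_seqP => n; apply/subsetPset; case: (fP _ (admF n)).
have cvgF : fine (P (F n)) @[n --> \oo] --> fine (P (\bigcup_n F n)).
  apply: fine_cvg; rewrite fineK ?fin_num_measure//.
  exact: nondecreasing_cvg_mu.
exists (\bigcup_n F n); split=> //.
  apply: (ler_cvg_to cvgF (cvg_cst p)).
  by apply: nearW => n; case: (admF n).
move=> B mB FB Bp.
have cvgFS : fine (P (F n.+1)) @[n --> \oo] --> fine (P (\bigcup_n F n)).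
  by rewrite (cvg_shiftS (fun n => fine (P (F n)))).
have cvgl : fine (P (F n)) + fine (P B) @[n --> \oo] -->
    fine (P (\bigcup_n F n)) + fine (P B) by exact: cvgD cvgF (cvg_cst _).
have cvgr : fine (P (F n.+1)) * 2 @[n --> \oo] -->
    fine (P (\bigcup_n F n)) * 2 by exact: cvgM cvgFS (cvg_cst _).
(* This is the limit of the halving inequality between [F n] and [F n.+1]. *)
suff : fine (P (\bigcup_n F n)) + fine (P B) <= fine (P (\bigcup_n F n)) * 2.
  lra.
apply: (ler_cvg_to cvgl cvgr).
apply: nearW => n /=; have [_ _] := fP _ (admF n); apply => //.
by apply: subset_trans FB; exact: bigcup_sup.
Qed.

(* Sierpinski's theorem: if [A] is maximal among the events of probability at
   most [p] and [P A < p], a small event outside [A] contradicts maximality. *)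
Lemma atomless_probability_onto (d : measure_display) (T : measurableType d)
    (R : realType) (P : probability T R) (p : R) :
  atomless P -> 0 <= p <= 1 -> exists2 A, measurable A & fine (P A) = p.
Proof.
move=> Pat /andP[p0 p1].
have [A [mA Ap Amax]] := exists_maximal_probability P p0.
exists A => //; apply/eqP; rewrite eq_le Ap leNgt; apply/negP => Altp.
have mAC := measurableC mA.
have AC0 : 0 < fine (P (~` A)).
  by rewrite -setTD probability_setD// probability_setT /=; lra.
have e0 : 0 < p - fine (P A) by lra.
have [B [mB BA B0 Be]] := atomless_small Pat mAC AC0 e0.
have PAB : fine (P (A `|` B)) = fine (P A) + fine (P B).
  rewrite measureU ?fineD ?fin_num_measure//.
  by apply/disjoints_subset => x Ax /BA.
have := Amax _ (measurableU _ _ mA mB) (@subsetUl _ _ _).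
rewrite PAB; lra.
Qed.

Lemma exists_RV_cdfR (d : measure_display) (T : measurableType d)
    (R : realType) (P : probability T R) (p x : R) :
  atomless P -> 0 <= p <= 1 ->
  exists X : {RV P >-> R}, cdfR X x = p /\ forall t, t < x -> cdfR X t = 0.
Proof.
move=> Pat /(atomless_probability_onto Pat)[A mA PA].
(* [Y] is [x] on [A] and [x + 1] off [A], so its CDF is 0 before [x] and jumps to [P A] at [x]. *)
pose Y t := x + 1 - \1_A t.
have mY : measurable_fun setT Y.
  by apply: measurable_funB => //; exact: measurable_indic.
pose X : {RV P >-> R} := mfun_Sub (mem_set mY).
have cdfX t : cdfR X t = fine (P (Y @^-1` `]-oo, t])) by [].
exists X; split=> [|t tx]; rewrite cdfX.
  rewrite -PA; congr (fine (P _)).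
  apply/seteqP; split=> t /=; rewrite in_itv/= /Y indicE.
    by case: (boolP (t \in A)) => [/set_mem//|_] /=; lra.
  by move=> /mem_set -> /=; lra.
rewrite (_ : _ @^-1` _ = set0) ?measure0//.
apply/seteqP; split=> // u /=; rewrite in_itv/= /Y indicE.
by case: (u \in A) => /=; lra.
Qed.

Lemma lambda_quantile_le (R : realType) (Lambda : R -> R) (F : CDF R) (x : R) :
  Lambda x <= F x -> (lambda_quantile Lambda F <= x%:E)%E.
Proof. by move=> xF; apply: ereal_inf_lbound; exists x. Qed.

(** As [g] preserves and reflects the order, both sides measure the same event. *)
Lemma cdfR_ordinal_transf (d : measure_display) (T : measurableType d)
    (R : realType) (P : probability T R) (X : {RV P >-> R})
    (g : ordinal_transf R) (y : R) :
  cdfR (g \o X : {RV P >-> R}) (g y) = cdfR X y.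
Proof.
rewrite /cdfR /cdf /distribution /pushforward/=; congr (fine (P _)).
by apply/seteqP; split=> t /=;
  rewrite !in_itv/= (le_mono (@ordinal_transf_incr R g)).
Qed.

Theorem theorem8p7 (d : measure_display) (T : measurableType d) (R : realType)
    (P : probability T R) (P_atomless : atomless P)
    (Lambda : R -> R) (Lambda01 : forall x : R, 0 <= Lambda x <= 1)
    (Lambda_std : standard_representation Lambda)
    (Lambda_att : attainment Lambda)
    (Lambda_fin : forall F : CDF R, lambda_quantile Lambda F \is a fin_num)
    (rho : {RV P >-> R} -> R)
    (rhoE : forall X : {RV P >-> R},
       (rho X)%:E = lambda_quantile Lambda (cdfR X)) :
  covariance_group rho = invariance_group Lambda.
Proof.
have gle (g : ordinal_transf R) : {mono g : x y / x <= y} :=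
  le_mono (@ordinal_transf_incr R g).
have rho_le (X : {RV P >-> R}) x : Lambda x <= cdfR X x -> rho X <= x.
  by move=> Lx; rewrite -lee_fin rhoE; exact: lambda_quantile_le.
have rho_att (X : {RV P >-> R}) : Lambda (rho X) <= cdfR X (rho X).
  by apply: Lambda_att; rewrite rhoE.
(* The zero set is closed upwards: a zero at [x < y] puts [lambda_N0 Lambda] below [y]. *)
have Lambda_zero x y : Lambda x = 0 -> x <= y -> Lambda y = 0.
  move=> x0; rewrite le_eqVlt => /predU1P[<-//|xy]; apply: Lambda_std.
  by apply: (@le_lt_trans _ _ x%:E); rewrite ?lte_fin//;
    apply: ereal_inf_lbound; exists x.
apply/seteqP; split => g /= gP.
  have rho_gle (X : {RV P >-> R}) x : Lambda (g x) <= cdfR X x -> rho X <= x.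
    by move=> gx; rewrite -(gle g) -gP; apply: rho_le; rewrite cdfR_ordinal_transf.
  have rho_gatt (X : {RV P >-> R}) : Lambda (g (rho X)) <= cdfR X (rho X).
    by rewrite -gP (le_trans (rho_att _))// gP cdfR_ordinal_transf.
  have zero x : Lambda x = 0 <-> Lambda (g x) = 0.
    (* The mass sits at [x + 1] so that the CDF vanishes at [x] too. A zero at [x] of either
       function gives [rho X <= x]; there attainment makes the other function vanish, and this zero
       propagates upwards. *)
    have [|X [_ X0]] := exists_RV_cdfR (p := 1) (x + 1) P_atomless.
      by rewrite ler01 lexx.
    have x1 t : t <= x -> t < x + 1 by lra.
    split=> x0.
      have rx : rho X <= x by apply: rho_le; rewrite x0 X0// x1.
      apply: (Lambda_zero (g (rho X))); rewrite ?gle//.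
      apply/eqP; rewrite eq_le; have /andP[-> _] := Lambda01 (g (rho X)).
      by rewrite -(X0 _ (x1 _ rx)) rho_gatt.
    have rx : rho X <= x by apply: rho_gle; rewrite x0 X0// x1.
    apply: (Lambda_zero (rho X)) => //.
    apply/eqP; rewrite eq_le; have /andP[-> _] := Lambda01 (rho X).
    by rewrite -(X0 _ (x1 _ rx)) rho_att.
  apply/funext => x /=.
  have [L0|L0] := eqVneq (Lambda x) 0; first by rewrite L0 (iffLR (zero x) L0).
  (* If [rho X < x], attainment makes [rho X] a zero of [Lambda], whence [Lambda x = 0], against
     [L0]. *)
  have rhoE_of (X : {RV P >-> R}) : (forall t, t < x -> cdfR X t = 0) ->
      rho X <= x -> rho X = x.
    move=> X0; rewrite le_eqVlt => /predU1P[//|ltx].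
    have := rho_att X; rewrite X0// => Lr.
    case/negP: L0; apply/eqP/(Lambda_zero (rho X)); last exact: ltW.
    by apply/eqP; rewrite eq_le Lr; case/andP: (Lambda01 (rho X)).
  (* Each half places [rho X] at [x] by minimality for one function and reads the inequality off
     attainment for the other. *)
  apply/eqP; rewrite eq_le; apply/andP; split.
    have [X [Xx X0]] := exists_RV_cdfR x P_atomless (Lambda01 x).
    have rX : rho X = x by apply: rhoE_of => //; apply: rho_le; rewrite Xx.
    by have := rho_gatt X; rewrite rX Xx.
  have [X [Xx X0]] := exists_RV_cdfR x P_atomless (Lambda01 (g x)).
  have rX : rho X = x by apply: rhoE_of => //; apply: rho_gle; rewrite Xx.
  by have := rho_att X; rewrite rX Xx.
move=> X; apply/eqP; rewrite eq_le; apply/andP; split.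
  apply: rho_le; rewrite cdfR_ordinal_transf.
  by rewrite -[Lambda _]/((Lambda \o g) _) gP.
(* By invariance, attainment for [g \o X] at [g y] becomes [Lambda y <= cdfR X y]. *)
have [y gy] := ordinal_transf_surj g (rho (g \o X : {RV P >-> R})).
rewrite -gy gle; apply: rho_le.
by rewrite -gP /= -(cdfR_ordinal_transf X g) gy.
Qed.
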